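(* For every pair of positive integers $k$ and $n$, we have $$\widetilde Y_n(\boldsymbol{x}^k)=T_n(\boldsymbol{x}^k)$$ as polynomials in $\boldsymbol{x}^k=(x_1,\dots,x_k)$, where $\widetilde Y_n$ and $T_n$ are the symmetric polynomials defined in the context.
   Context: Let $p_j(\boldsymbol{x}^k)=x_1^j+\cdots+x_k^j$ be the power sums. The Bernoulli numbers $B_n$ are defined by $\frac{z}{e^z-1}=\sum_{n\ge0}B_n\frac{z^n}{n!}$. Definition of $\widetilde Y_n$. For a partition $\lambda=(1^{m_1},2^{m_2},\dots,r^{m_r})\vdash r$ ($m_j$ is the multiplicity of $j$), put $$\phi_U(\lambda)=(2r+1)!\,4^r\prod_{j=1}^r\frac{1}{m_j!}\left(\frac{B_{2j}}{(2j)(2j)!}\right)^{m_j},\qquad p_\lambda=p_2^{m_1}p_4^{m_2}\cdots p_{2r}^{m_r}.$$ Ramanujan's quasimodular form $U_{2r}(q)$ equals $\sum_{\lambda\vdash r}\phi_U(\lambda)E_2^{m_1}E_4^{m_2}\cdots E_{2r}^{m_r}$ with $E_{2j}$ the Eisenstein series, and its symmetric function counterpart, obtained by the substitution $E_{2j}\mapsto p_{2j}$ in this expression, is $$\Psi(U_{2r})=\sum_{\lambda\vdash r}\phi_U(\lambda)\,p_\lambda,\qquad \Psi(U_0)=1.$$ Then (the weight $1$ form $\theta(q)^2$ being sent to $p_1$) $$\widetilde Y_n(\boldsymbol{x}^k)=\frac{1}{(n+1)2^n}\sum_{r=0}^{\lfloor n/2\rfloor}\binom{n+1}{2r+1}\,p_1(\boldsymbol{x}^k)^{n-2r}\,\Psi(U_{2r})(\boldsymbol{x}^k).$$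 Definition of $T_n$. For $N\ge 1$ let $$P_N(\boldsymbol{x}^k)=\sum_{j}x_j^N-\sum_{j<r}(x_j+x_r)^N+\sum_{j<r<i}(x_j+x_r+x_i)^N-\cdots-(-1)^k\Big(\sum_{j=1}^kx_j\Big)^N=\sum_{\emptyset\ne S\subseteq\{1,\dots,k\}}(-1)^{|S|-1}\Big(\sum_{j\in S}x_j\Big)^N.$$ The polynomial $T_n(\boldsymbol{x}^k)$, $n\ge0$, is defined by $$P_{n+k}(\boldsymbol{x}^k)=(-1)^{k+1}\frac{(n+k)!}{n!}\,x_1x_2\cdots x_k\;T_n(\boldsymbol{x}^k),$$ with $T_0=1$. *)

(* Defs.v *)
From HB Require Import structures.
From mathcomp Require Import all_boot all_order all_algebra.
From mathcomp.multinomials Require Import mpoly.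
From mathcomp Require Import ring.

Set Implicit Arguments.
Unset Strict Implicit.
Unset Printing Implicit Defensive.

Import GRing.Theory Num.Theory.

Local Open Scope ring_scope.

(* Formal power series over rat are given by their coefficient sequences.     *)
Definition fps_mul (u v : nat -> rat) (n : nat) : rat :=
  \sum_(j < n.+1) u j * v (n - j)%N.

Definition fps_expm1 (n : nat) : rat := if n == 0%N then 0 else (n`!%:R)^-1.

Definition fps_X (n : nat) : rat := (n == 1%N)%:R.

Definition is_bernoulli (b : nat -> rat) : Prop :=
  fps_mul (fun n => b n / n`!%:R) fps_expm1 =1 fps_X.

(* The coefficients of z^(n+1) in                                             *)
(*   (\sum_n b_n z^n / n!) (e^z - 1) = z                                      *)
(* determine b_n from b_0, ..., b_(n-1).                                      *)
Fixpoint bernoulli_seq (n : nat) : seq rat :=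
  if n is n'.+1 then
    let s := bernoulli_seq n' in
    rcons s ((n' == 0%N)%:R -
             (n'.+1%:R)^-1 * \sum_(j < n') 'C(n'.+1, j)%:R * s`_j)
  else [::].

Definition bernoulli (n : nat) : rat := (bernoulli_seq n.+1)`_n.

Definition power_sum (k j : nat) : {mpoly rat[k]} := \sum_(i < k) 'X_i ^+ j.

(* The partition (1^m_1, 2^m_2, ..., r^m_r) of r is encoded by its            *)
(* multiplicities, m_j being the value at the ordinal j - 1; all of them are  *)
(* at most r.                                                                 *)
Definition is_partition (r : nat) (m : {ffun 'I_r -> 'I_r.+1}) : bool :=
  (\sum_(j < r) j.+1 * m j == r)%N.

Definition phiU (r : nat) (m : {ffun 'I_r -> 'I_r.+1}) : rat :=
  (r.*2.+1)`!%:R * 4 ^+ r *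
  \prod_(j < r) ((m j)`!%:R^-1 *
    (bernoulli (j.+1).*2 / ((j.+1).*2%:R * ((j.+1).*2)`!%:R)) ^+ m j).

Definition p_part (k r : nat) (m : {ffun 'I_r -> 'I_r.+1}) : {mpoly rat[k]} :=
  \prod_(j < r) power_sum k (j.+1).*2 ^+ m j.

Definition PsiU (k r : nat) : {mpoly rat[k]} :=
  \sum_(m : {ffun 'I_r -> 'I_r.+1} | is_partition m) phiU m *: p_part k m.

Definition Ytilde (k n : nat) : {mpoly rat[k]} :=
  (n.+1%:R * 2 ^+ n)^-1 *:
  \sum_(0 <= r < (n./2).+1)
     'C(n.+1, r.*2.+1)%:R *: (power_sum k 1 ^+ (n - r.*2) * PsiU k r).

Definition altP (k N : nat) : {mpoly rat[k]} :=
  \sum_(S : {set 'I_k} | S != set0)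
     (-1) ^+ (#|S|.-1) *: (\sum_(j in S) 'X_j) ^+ N.

Definition T_eqn (k n : nat) (U : {mpoly rat[k]}) : Prop :=
  altP k (n + k)%N =
  ((-1) ^+ k.+1 * ((n + k)%N`!%:R / n`!%:R)) *: ((\prod_(i < k) 'X_i) * U).

(* The quotient of p by x_1 ... x_k, when the latter divides p.               *)
Definition mdiv_vars (k : nat) (p : {mpoly rat[k]}) : {mpoly rat[k]} :=
  let e := [multinom 1%N | i < k] in
  \sum_(m <- msupp p | (e <= m)%MM) p@_m *: 'X_[m - e].

(* T k n is the unique solution of T_eqn n: see T_eqnP below.                 *)
Definition T (k n : nat) : {mpoly rat[k]} :=
  ((-1) ^+ k.+1 * ((n + k)%N`!%:R / n`!%:R))^-1 *: mdiv_vars (altP k (n + k)%N).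

Lemma size_bernoulli_seq n : size (bernoulli_seq n) = n.
Proof. by elim: n => //= n IHn; rewrite size_rcons IHn. Qed.

Lemma nth_bernoulli_seq n j : (j < n)%N -> (bernoulli_seq n)`_j = bernoulli j.
Proof.
elim: n => // n IHn; rewrite ltnS leq_eqVlt => /orP[/eqP -> //|jn].
by rewrite /= nth_rcons size_bernoulli_seq jn IHn.
Qed.

Lemma bernoulliE n :
  bernoulli n = (n == 0%N)%:R -
    (n.+1%:R)^-1 * \sum_(j < n) 'C(n.+1, j)%:R * bernoulli j.
Proof.
rewrite {1}/bernoulli /= nth_rcons size_bernoulli_seq ltnn eqxx.
congr (_ - _ * _); apply: eq_bigr => j _.
by rewrite nth_bernoulli_seq.
Qed.

Lemma factr_neq0 n : n`!%:R != 0 :> rat.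
Proof. by rewrite pnatr_eq0 -lt0n fact_gt0. Qed.

Lemma fps_mul_expm1S (b : nat -> rat) n :
  fps_mul (fun i => b i / i`!%:R) fps_expm1 n.+1 * n.+1`!%:R =
  n.+1%:R * b n + \sum_(j < n) 'C(n.+1, j)%:R * b j.
Proof.
have binE (j : nat) : (j <= n)%N ->
    b j / j`!%:R * fps_expm1 (n.+1 - j) * n.+1`!%:R = 'C(n.+1, j)%:R * b j.
  move=> jn; rewrite /fps_expm1 subn_eq0 leqNgt ltnS jn /=.
  rewrite -(@bin_fact n.+1 j) ?leqW // !natrM.
  by field; rewrite !factr_neq0.
rewrite /fps_mul big_ord_recr /= subnn {2}/fps_expm1 eqxx mulr0 addr0.
rewrite mulr_suml big_ord_recr /= binE // binSn addrC; congr (_ + _).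
by apply: eq_bigr => j _; rewrite binE // ltnW.
Qed.

Lemma is_bernoulliE (b : nat -> rat) :
  is_bernoulli b <->
  forall n, n.+1%:R * b n + \sum_(j < n) 'C(n.+1, j)%:R * b j = (n == 0%N)%:R.
Proof.
have XE n : fps_X n.+1 * n.+1`!%:R = (n == 0%N)%:R.
  by rewrite /fps_X eqSS; case: n => [|n]; rewrite ?mul0r ?mulr1.
split=> [bP n|bP [|n]]; first by rewrite -fps_mul_expm1S bP XE.
  by rewrite /fps_mul big_ord1 /fps_expm1 mulr0.
by apply: (mulIf (factr_neq0 n.+1)); rewrite fps_mul_expm1S XE.
Qed.

Lemma is_bernoulliP (b : nat -> rat) : is_bernoulli b <-> b =1 bernoulli.
Proof.
have n1 n : n.+1%:R != 0 :> rat by rewrite pnatr_eq0.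
have BP n : n.+1%:R * bernoulli n +
    \sum_(j < n) 'C(n.+1, j)%:R * bernoulli j = (n == 0)%:R.
  rewrite bernoulliE mulrBr mulVKf // addrNK.
  by case: n => [|n]; rewrite ?mulr1 ?mulr0.
rewrite is_bernoulliE; split=> [bP|bE n]; last first.
  by rewrite bE -[RHS]BP; congr (_ + _); apply: eq_bigr => j _; rewrite bE.
elim/ltn_ind => n IHn; apply: (mulfI (n1 n)).
apply: (addIr (\sum_(j < n) 'C(n.+1, j)%:R * b j)).
rewrite bP -[LHS]BP; congr (_ + _).
by apply: eq_bigr => j _; rewrite IHn.
Qed.

Section DivVars.
Variable k : nat.
Implicit Types (p : {mpoly rat[k]}) (i : 'I_k) (m : 'X_{1..k}).

Let e : 'X_{1..k} := [multinom 1%N | i < k].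

Lemma prod_varsE : \prod_(i < k) 'X_i = 'X_[e] :> {mpoly rat[k]}.
Proof. by rewrite mpolyXE_id; apply: eq_bigr => i _; rewrite mnmE expr1. Qed.

Lemma mdiv_varsK p :
  (forall m, ~~ (e <= m)%MM -> p@_m = 0) -> 'X_[e] * mdiv_vars p = p.
Proof.
move=> p0; rewrite /mdiv_vars big_distrr /= [RHS]mpolyE [RHS](bigID (fun m => e <= m)%MM) /=.
rewrite [X in _ = _ + X]big1 ?addr0 => [|m /p0 ->]; last by rewrite scale0r.
apply: eq_bigr => m em.
by rewrite -scalerAr -mpolyXD addmC submK.
Qed.

Lemma mcoeff_XMn0 i p m : m i = 0%N -> ('X_i * p)@_m = 0.
Proof.
move=> mi0; rewrite mulrC mcoeffMr big1 // => -[m1 m2] /= /eqP mE.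
rewrite mcoeffX; case: eqP => [m2E|_]; last by rewrite mulr0.
have /(congr1 (fun m' : 'X_{1..k} => m' i)) := mE.
by rewrite mi0 mnmDE -m2E mnm1E eqxx add1n.
Qed.

Lemma mcoeff_expXD i p m N :
  m i = 0%N -> (('X_i + p) ^+ N)@_m = (p ^+ N)@_m.
Proof.
move=> mi0; apply/eqP; rewrite -subr_eq0 -mcoeffB subrXX addrK.
by rewrite mcoeff_XMn0.
Qed.

Lemma mcoeff_altP N m : (0 < N)%N -> ~~ (e <= m)%MM -> (altP k N)@_m = 0.
Proof.
move=> N0 /mnm_lepP em.
have [i /eqP mi0] : exists i, m i == 0%N.
  apply/existsP; apply: contra_notT em => /existsPn h i.
  by rewrite mnmE lt0n; apply: h.
pose F (S : {set 'I_k}) : rat :=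
  (-1) ^+ (#|S|.+1) * ((\sum_(j in S) 'X_j : {mpoly rat[k]}) ^+ N)@_m.
have -> : (altP k N)@_m = \sum_S F S.
  rewrite [RHS](bigD1 set0) //= {1}/F big_set0 expr0n gtn_eqF //.
  rewrite mcoeff0 mulr0 add0r /altP raddf_sum /=; apply: eq_bigr => S S0.
  rewrite mcoeffZ /F; congr (_ * _); rewrite -card_gt0 in S0.
  by rewrite -{2}(prednK S0) !exprS !mulN1r opprK.
rewrite (bigID (fun S : {set 'I_k} => i \in S)) /=.
rewrite (reindex_onto (fun S => i |: S) (fun S => S :\ i)) /=; last first.
  by move=> S iS; rewrite setD1K.
rewrite [X in X + _](eq_bigl (fun S : {set 'I_k} => i \notin S)); last first.
  move=> S; rewrite /= setU11 /=; apply/eqP/idP => [<-|iS]; last exact: setU1K.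
  by rewrite !inE eqxx.
rewrite -big_split big1 //= => S iS.
rewrite /F cardsU1 iS add1n big_setU1 //= mcoeff_expXD //.
by rewrite [X in X * _]exprS mulN1r mulNr addNr.
Qed.

End DivVars.

Lemma T_eqnP (k n : nat) (U : {mpoly rat[k]}) : T_eqn n U <-> U = T k n.
Proof.
rewrite /T_eqn /T prod_varsE.
set c := (X in X *: ( _ * _)).
have c0 : c != 0.
  by rewrite mulf_neq0 ?signr_eq0 // mulf_neq0 ?invr_eq0 ?factr_neq0.
have divK : 'X_[[multinom 1%N | i < k]] * mdiv_vars (altP k (n + k)) =
            altP k (n + k).
  apply: mdiv_varsK => m em; apply: mcoeff_altP => //.
  rewrite addn_gt0 orbC lt0n; apply/orP; left.
  apply: contra em => /eqP k0; apply/mnm_lepP => i.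
  by exfalso; case: i => j; rewrite k0.
split=> [|->]; last by rewrite -scalerAr scalerA divff // scale1r divK.
rewrite -{1}divK => h.
have X0 : 'X_[[multinom 1%N | i < k]] != 0 :> {mpoly rat[k]}.
  by rewrite -msupp_eq0 msuppX.
apply: (mulfI X0).
by rewrite -scalerAr h scalerA mulVf // scale1r.
Qed.

(* Main.v *)
Require Import Defs.
From mathcomp Require Import all_boot all_order all_algebra.
From mathcomp.multinomials Require Import mpoly.
From mathcomp Require Import ring.

Set Implicit Arguments.
Unset Strict Implicit.
Unset Printing Implicit Defensive.

Import GRing.Theory Num.Theory.

Local Open Scope ring_scope.

(** Both sides are n! times the coefficient of t^n in
      \prod_i (e^(x_i t) - 1) / (x_i t).

    For T, expand the exponential generating function of the P_N over the
    nonempty subsets S of the variables: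
      \sum_S (-1)^(|S|-1) e^(t x_S) = 1 - \prod_i (1 - e^(x_i t)),
    and divide each factor e^(x_i t) - 1 by x_i t (altP_gf, T_gf).

    For Ytilde, the sum over r is the Cauchy product of e^(p_1 t / 2) with
      exp (\sum_(j >= 1) B_(2j) p_(2j) t^(2j) / (2j (2j)!)),
    whose expansion over partitions has the polynomials
    PsiU k r / ((2r+1)! 4^r) as coefficients (PsiUE, Ytilde_gf).

    The two series agree because
      log ((e^z - 1) / z) =
        z / 2 + \sum_(j >= 1) B_(2j) z^(2j) / (2j (2j)!).
    Logarithms are avoided by comparing logarithmic derivatives: a series A
    with a given constant term is determined by the series L such that
    t A' = A L, and the L of a product is the sum of those of its factors
    (logder_inj, logder_prod).  The factor (e^z - 1) / z has
    L = z / (e^z - 1) + z - 1 (logder_expm1_div).  The reflection formula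
    B(-z) = B(z) + z for B(z) = z / (e^z - 1) shows that B_1 is the only odd
    Bernoulli number that contributes (bernoulli_gf_opp, bernoulli_gf_even),
    so that L is the logarithmic derivative of the right-hand side above.

    Power series over R are represented by polynomials in {poly R} that are
    compared up to a fixed degree N. *)

(** * Truncated power series and logarithmic derivatives *)

Section Truncation.
Variable R : comNzRingType.
Implicit Types (p q A B L : {poly R}) (N : nat).

(** Congruence modulo X^(N+1). *)
Definition eqX N p q := forall i, (i <= N)%N -> p`_i = q`_i.

Lemma eqX_sym N p q : eqX N p q -> eqX N q p.
Proof. by move=> h i /h. Qed.

Lemma eqX_trans N p q r : eqX N p q -> eqX N q r -> eqX N p r.
Proof. by move=> h1 h2 i iN; rewrite h1 ?h2. Qed.

Lemma eqX_add N p p' q q' : eqX N p p' -> eqX N q q' -> eqX N (p + q) (p' + q').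
Proof. by move=> hp hq i iN; rewrite !coefD hp ?hq. Qed.

Lemma eqX_mul N p p' q q' : eqX N p p' -> eqX N q q' -> eqX N (p * q) (p' * q').
Proof.
move=> hp hq i iN; rewrite !coefM; apply: eq_bigr => -[j /= ji] _.
by rewrite hp ?hq // ?(leq_trans (leq_subr _ _)) // (leq_trans _ iN).
Qed.

Lemma eqX_prod N (I : finType) (P : pred I) (F G : I -> {poly R}) :
  (forall i, P i -> eqX N (F i) (G i)) ->
  eqX N (\prod_(i | P i) F i) (\prod_(i | P i) G i).
Proof. by move=> h; elim/big_ind2: _ => // *; apply: eqX_mul. Qed.

Lemma eqX_mulXn0 N m p : (N < m)%N -> eqX N (p * 'X^m) 0.
Proof. by move=> Nm i iN; rewrite coefMXn coef0 (leq_ltn_trans iN Nm). Qed.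

(** L is X A'/A, the logarithmic derivative of A for the Euler operator X d/dX,
    which preserves degrees, so that no precision is lost in the truncation. *)
Definition logder N A L := eqX N ('X * A^`()) (A * L).

Lemma logder_eqX N A L L' : eqX N L L' -> logder N A L -> logder N A L'.
Proof. by move=> h hA; apply: (eqX_trans hA); apply: eqX_mul. Qed.

Lemma logder_mul N A B L M :
  logder N A L -> logder N B M -> logder N (A * B) (L + M).
Proof.
move=> hA hB; rewrite /logder derivM.
rewrite (_ : 'X * _ = 'X * A^`() * B + A * ('X * B^`())); last by ring.
rewrite (_ : A * B * _ = A * L * B + A * (B * M)); last by ring.
by apply: eqX_add; apply: eqX_mul.
Qed.

Lemma logder_prod N (I : finType) (P : pred I) (A L : I -> {poly R}) :
  (forall i, P i -> logder N (A i) (L i)) ->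
  logder N (\prod_(i | P i) A i) (\sum_(i | P i) L i).
Proof.
move=> h; elim/big_ind2: _ => //; last by move=> *; apply: logder_mul.
by rewrite /logder derivE mulr0 mul1r.
Qed.

End Truncation.

Section LogDerivative.
Variable R : comAlgType rat.
Implicit Types (A B L u : {poly R}) (N : nat) (x : R).

Lemma mulrSI n : injective (fun a : R => a *+ n.+1).
Proof.
move=> a b; rewrite -!scaler_nat => /(congr1 ( *:%R n.+1%:R^-1)).
by rewrite !scalerA mulVf ?pnatr_eq0 // !scale1r.
Qed.

(** In degree n the equation X A' = A L reads
    n A_n = \sum_(j < n) A_j L_(n - j), since L_0 = 0; in characteristic 0 this
    recursion determines A from A_0. *)
Lemma logder_inj N A B L : L`_0 = 0 -> A`_0 = B`_0 ->
  logder N A L -> logder N B L -> eqX N A B.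
Proof.
move=> L0 AB0 hA hB; elim/ltn_ind => -[//|n] IHn nN.
apply: (@mulrSI n); move: (hA _ nN) (hB _ nN).
rewrite !coefXM !coef_deriv /= => -> ->.
rewrite !coefM !(big_ord_recr n.+1) /= subnn L0 !mulr0 !addr0.
by apply: eq_bigr => -[j /= jn] _; rewrite IHn // ltnW // (leq_trans jn).
Qed.

(** * Truncated exponentials *)

Definition expX N u : {poly R} :=
  \sum_(m < N.+1) ((m`!%:R)^-1 : rat)%:A *: u ^+ m.

Lemma expX_exprX u m N : u`_0 = 0 -> (N < m)%N -> eqX N (u ^+ m) 0.
Proof.
move=> u0 Nm; have uE : u = drop_poly 1 u * 'X.
  apply/polyP => -[|i]; rewrite coefMX //= coef_drop_poly ?addn1 //.
by rewrite uE exprMn; apply: eqX_mulXn0.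
Qed.

Lemma deriv_expX N u : (expX N.+1 u)^`() = u^`() * expX N u.
Proof.
rewrite /expX raddf_sum big_ord_recl /= expr0 derivZ derivE scaler0 add0r.
rewrite mulr_sumr; apply: eq_bigr => i _.
rewrite derivZ deriv_exp /= -scalerAr -scaler_nat scalerA; congr (_ *: _).
rewrite -scaler_nat -scalerAl mul1r scalerA; congr (_ *: _).
by rewrite factS natrM invfM mulrAC mulVf ?pnatr_eq0 // mul1r.
Qed.

(** The derivative of the exponential series truncated at u^(N+1) is u' times
    the one truncated at u^N; the missing term is a multiple of X u^(N+1), which
    vanishes up to degree N + 1. *)
Lemma logder_expX N u (u0 : u`_0 = 0) : logder N (expX N u) ('X * u^`()).
Proof.
case: N => [|N].
  move=> [|//] _; rewrite coefXM coefM big_ord1 coefXM /= mulr0 //.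
rewrite /logder deriv_expX {2}/expX big_ord_recr /= -/(expX N u).
rewrite mulrA mulrC [X in eqX _ _ X]mulrDl -[X in eqX _ X _]addr0.
apply: eqX_add => //; apply: eqX_sym.
move=> i iN; rewrite -scalerAl coefZ mulrCA coefXM.
case: i iN => [|i] iN /=; rewrite ?coef0 ?mulr0 //.
have := eqX_mul (fun i _ => erefl (u^`()`_i)) (expX_exprX u0 (ltnSn N)) iN.
by rewrite mulr0 mulrC coef0 => ->; rewrite mulr0.
Qed.

Lemma expX0 N u : u`_0 = 0 -> (expX N u)`_0 = 1.
Proof.
move=> u0; rewrite /expX big_ord_recl coefD coefZ coef1 mulr1 invr1 scale1r.
rewrite coef_sum big1 ?addr0 // => i _.
by rewrite coefZ (@expX_exprX _ _ 0) // coef0 mulr0.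
Qed.

Lemma coef_expX_linear N x i : (i <= N)%N ->
  (expX N (x *: 'X))`_i = (i`!%:R^-1 : rat) *: x ^+ i.
Proof.
move=> iN; rewrite coef_sum (bigD1 (Ordinal (iN : (i < N.+1)%N))) //= big1.
  by rewrite addr0 exprZn coefZ coefZ coefXn eqxx mulr1 mulr_algl.
move=> j /negPf ji; rewrite exprZn !coefZ coefXn eq_sym.
by move: ji; rewrite -val_eqE /= => ->; rewrite !mulr0.
Qed.

Lemma linear0 x : (x *: 'X : {poly R})`_0 = 0.
Proof. by rewrite coefZ coefX mulr0. Qed.

Lemma logder_expX_monomial N w x : (0 < w)%N ->
  logder N (expX N (x *: 'X^w)) ((x *+ w) *: 'X^w).
Proof.
case: w => // w _.
have u0 : (x *: 'X^(w.+1))`_0 = 0 by rewrite coefZ coefXn mulr0.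
apply: (logder_eqX _ (logder_expX u0)) => i _.
rewrite derivZ derivXn /= coefXM !coefZ !coefMn !coefXn.
case: i => [|i] /=; rewrite ?mulr0 // eqSS.
by case: (i == w); rewrite ?mul0rn ?mulr0 ?mulrnAr ?mulr1.
Qed.

Lemma logder_expX_linear N x : logder N (expX N (x *: 'X)) (x *: 'X).
Proof. exact: (@logder_expX_monomial N 1). Qed.

(** The functional equation of the exponential, as both sides have the same
    logarithmic derivative. *)
Lemma prod_expX_linear N (I : finType) (P : pred I) (x : I -> R) :
  eqX N (\prod_(i | P i) expX N (x i *: 'X))
        (expX N ((\sum_(i | P i) x i) *: 'X)).
Proof.
apply: (@logder_inj _ _ _ ((\sum_(i | P i) x i) *: 'X)).
- exact: linear0.
- rewrite coef0_prod expX0 ?linear0 // big1 // => i _.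
  by rewrite expX0 ?linear0.
- by rewrite scaler_suml; apply: logder_prod => i _; apply: logder_expX_linear.
- exact: logder_expX_linear.
Qed.

End LogDerivative.

(** * Bernoulli numbers and the series (e^z - 1) / z *)

Section Bernoulli.
Variable R : comAlgType rat.
Implicit Types (x : R) (N : nat).

(** The series (e^(xX) - 1) / (xX). *)
Definition expm1_div N x : {poly R} :=
  \poly_(i < N.+1) ((i.+1)`!%:R^-1 *: x ^+ i).

(** The series xX / (e^(xX) - 1). *)
Definition bernoulli_gf N x : {poly R} :=
  \poly_(i < N.+1) ((bernoulli i / i`!%:R) *: x ^+ i).

Lemma coef_expm1_div N x i :
  (i <= N)%N -> (expm1_div N x)`_i = (i.+1)`!%:R^-1 *: x ^+ i.
Proof. by move=> iN; rewrite coef_poly ltnS iN. Qed.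

Lemma coef_bernoulli_gf N x i :
  (i <= N)%N -> (bernoulli_gf N x)`_i = (bernoulli i / i`!%:R) *: x ^+ i.
Proof. by move=> iN; rewrite coef_poly ltnS iN. Qed.

Lemma expX_expm1_div N x :
  eqX N (expX N (x *: 'X)) (1 + (x *: 'X) * expm1_div N x).
Proof.
move=> [|i] iN;
  rewrite coef_expX_linear // coefD coef1 -scalerAl coefZ coefXM /=.
  by rewrite mulr0 addr0 invr1 scale1r.
by rewrite coef_expm1_div ?(ltnW iN) // add0r -scalerAr exprS.
Qed.

Lemma bernoulli_gf_mul N x : eqX N (bernoulli_gf N x * expm1_div N x) 1.
Proof.
move=> i iN; rewrite coefM coef1.
have /is_bernoulliP/(_ i.+1) : bernoulli =1 bernoulli by [].
rewrite /fps_mul big_ord_recr /= subnn {2}/fps_expm1 eqxx mulr0 addr0.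
rewrite /fps_X eqSS => bE.
transitivity (((i == 0%N)%:R : rat) *: x ^+ i); last first.
  by case: i {iN bE} => [|i] /=; rewrite ?scale1r ?scale0r.
rewrite -bE scaler_suml; apply: eq_bigr => -[j /= ji] _.
rewrite coef_bernoulli_gf ?(leq_trans _ iN) //.
rewrite coef_expm1_div ?(leq_trans (leq_subr _ _)) //.
rewrite -scalerAl -scalerAr scalerA -exprD subnKC // /fps_expm1 subSn //.
Qed.

(** The coefficient form of ((e^(-z) - 1) / (-z)) e^z = (e^z - 1) / z.  Up to
    the factor (n + 1)!, the sum is the opposite of the expansion of
    (1 - 1)^(n+1) without its first term 1. *)
Lemma sum_alt_fact n : \sum_(j < n.+1)
  (-1) ^+ j / ((j.+1)`!%:R * (n - j)`!%:R) = (n.+1)`!%:R^-1 :> rat.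
Proof.
have f0 := factr_neq0.
apply: (mulfI (f0 n.+1)); rewrite mulfV // mulr_sumr.
have /esym := exprBn (1 : rat) 1 n.+1.
rewrite subrr expr0n /= big_ord_recl /= expr0 !expr1n bin0 !mul1r mulr1n.
move/eqP; rewrite addr_eq0 => /eqP one; rewrite [RHS]one.
rewrite -sumrN; apply: eq_bigr => -[j /= jn] _.
rewrite !expr1n !mulr1 /bump /= add1n exprS mulN1r mulNrn opprK.
rewrite -(bin_fact (jn : (j.+1 <= n.+1)%N)) subSS natrM natrM.
move: (f0 j.+1) (f0 (n - j)%N); move: (_`!%:R) (_`!%:R) => a b a0 b0.
by field; rewrite a0 b0.
Qed.

Lemma expm1_div_opp N x :
  eqX N (expm1_div N (- x) * expX N (x *: 'X)) (expm1_div N x).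
Proof.
move=> i iN; rewrite coef_expm1_div // coefM -sum_alt_fact scaler_suml.
apply: eq_bigr => -[j /= ji] _.
rewrite coef_expm1_div ?(leq_trans _ iN) //.
rewrite coef_expX_linear ?(leq_trans (leq_subr _ _)) //.
rewrite (exprNn x) -(signr_odd rat) -(signr_odd R).
rewrite -scalerAl -scalerAr scalerA -mulrA -exprD subnKC // invfM.
by case: (odd j); rewrite ?expr1 ?expr0 ?mul1r // !mulN1r scalerN scaleNr.
Qed.

(** The reflection formula B(-z) = B(z) + z, whose coefficients say that
    B_1 = - 1/2 and that the odd B_n with n > 1 vanish. *)
Lemma bernoulli_gf_opp N x :
  eqX N (bernoulli_gf N (- x)) (bernoulli_gf N x + x *: 'X).
Proof.
set B := bernoulli_gf N x; set B' := bernoulli_gf N (- x).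
set H := expm1_div N x; set H' := expm1_div N (- x); set e := expX N (x *: 'X).
have BH : eqX N (B * H) 1 by exact: bernoulli_gf_mul.
have B'H' : eqX N (B' * H') 1 by exact: bernoulli_gf_mul.
have He : eqX N (H' * e) H by exact: expm1_div_opp.
have eE : eqX N e (1 + x *: 'X * H) by exact: expX_expm1_div.
have refl (p : {poly R}) : eqX N p p by [].
(* B' = B' B H = B' B (H' e) = B e = B + x X (B H) = B + x X. *)
apply: (@eqX_trans _ _ _ (B' * (B * H))).
  by rewrite -{1}[B']mulr1; apply: eqX_mul => //; apply: eqX_sym.
apply: (@eqX_trans _ _ _ (B' * (B * (H' * e)))).
  by do 2!apply: eqX_mul => //; apply: eqX_sym.
rewrite (_ : B' * _ = B' * H' * (B * e)); last by ring.
apply: (@eqX_trans _ _ _ (1 * (B * (1 + x *: 'X * H)))).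
  by apply: eqX_mul => //; apply: eqX_mul.
rewrite (_ : 1 * _ = B + x *: 'X * (B * H)); last by ring.
by apply: eqX_add => //; rewrite -{2}[x *: 'X]mulr1; apply: eqX_mul.
Qed.

(** From z H = e^z - 1 one gets z H' = e^z - H, and dividing by H, with
    1 / H = B and e^z = 1 + z H, gives z H' / H = B + z - 1. *)
Lemma logder_expm1_div N x :
  logder N (expm1_div N x) (bernoulli_gf N x + x *: 'X - 1).
Proof.
have H0 : eqX N ('X * (expm1_div N x)^`()) (expX N (x *: 'X) - expm1_div N x).
  move=> i iN; rewrite coefB coef_expX_linear // coef_expm1_div // -scalerBl.
  rewrite coefXM coef_deriv; case: i iN => [|i] iN /=.
    by rewrite subrr scale0r.
  rewrite coef_expm1_div // -scaler_nat scalerA; congr (_ *: _).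
  rewrite (factS i.+1) natrM invfM -[i.+2%:R]natr1.
  have : i.+1%:R + 1 != 0 :> rat by rewrite natr1 pnatr_eq0.
  move: (_`!%:R^-1) (i.+1%:R) => f m m1.
  by field.
apply: (eqX_trans H0); rewrite mulrBr mulr1; apply: eqX_add => //.
apply: (eqX_trans (@expX_expm1_div N x)).
rewrite mulrDr [expm1_div N x * bernoulli_gf N x]mulrC [_ * (x *: 'X)]mulrC.
by apply: eqX_add => //; apply: eqX_sym; apply: bernoulli_gf_mul.
Qed.

(** The term xX turns B_1 = - 1/2 into 1/2, and -1 cancels B_0. *)
Lemma bernoulli_gf_even N x :
  eqX N (bernoulli_gf N x + x *: 'X - 1)
    ((2^-1 *: x) *: 'X + \sum_(j < N)
       ((bernoulli (j.+1).*2 / ((j.+1).*2)`!%:R) *: x ^+ (j.+1).*2)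
         *: 'X^((j.+1).*2)).
Proof.
move=> i iN; rewrite coefB !coefD coef1 !coefZ coefX.
rewrite coef_bernoulli_gf // coef_sumMXn.
have B0 : bernoulli 0 = 1 by rewrite bernoulliE big_ord0 mulr0 subr0.
have [i_odd|i_even] := boolP (odd i).
  rewrite big_pred0 => [|j]; last first.
    by apply: contraTF i_odd => /eqP <-; rewrite odd_double.
  case: i => [//|[|i]] in iN i_odd *.
    have -> : bernoulli 1 = - 2^-1 by rewrite bernoulliE big_ord1 B0.
    rewrite !mulr1 subr0 addr0 -{2}[x]scale1r -scalerDl; congr (_ *: _).
  (* Reflection gives - B_i x^i = B_i x^i for odd i > 1. *)
  have := bernoulli_gf_opp x iN; rewrite coefD coefZ coefX.
  rewrite coef_bernoulli_gf // coef_bernoulli_gf //.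
  rewrite exprNn -signr_odd i_odd expr1 mulN1r scalerN !mulr0 !addr0 subr0.
  set b := _ *: _ => /eqP; rewrite eq_sym -addr_eq0 -mulr2n => /eqP b0.
  by apply: (@mulrSI _ 1); rewrite b0 mul0rn.
case: i => [|i] in iN i_even *.
  by rewrite big_pred0 // B0 divr1 scale1r !mulr0 !addr0 subrr.
have [j ij] : exists j, i.+1 = j.+1.*2.
  rewrite /= negbK in i_even; exists i./2.
  by rewrite -[in LHS](odd_double_half i) i_even add1n doubleS.
have jN : (j < N)%N.
  by rewrite (leq_trans _ iN) // ij -addnn addSn ltnS leq_addr.
rewrite (big_pred1 (Ordinal jN)) /= => [|j']; last first.
  by rewrite ij (inj_eq double_inj) eqSS.
have jX : (j.+1.*2 == 1%N) = false by [].
by rewrite ij jX !mulr0 subr0 addr0 add0r.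
Qed.

End Bernoulli.

(** * Expansion of an exponential over partitions *)

Section EvenExponential.
Variables (R : comAlgType rat) (c : nat -> R).

(** The series exp (\sum_(j >= 1) c_(j-1) X^(2j)), correct up to degree
    2 M + 1. *)
Definition even_exp M : {poly R} :=
  \prod_(j < M) expX M (c j *: 'X^((j.+1).*2)).

Lemma expX_trunc K n d (u : {poly R}) :
  (forall m, (n < m)%N -> eqX K (u ^+ m) 0) ->
  eqX K (expX (n + d) u) (expX n u).
Proof.
move=> u0; elim: d => [|d IHd]; first by rewrite addn0.
rewrite addnS /expX big_ord_recr /= -[X in eqX _ _ X]addr0.
apply: eqX_add => // i iK.
by rewrite coefZ (u0 (n + d).+1) ?ltnS ?leq_addr // !coef0 mulr0.
Qed.

(** The factors of index j >= r and the terms of exponent m > r in the others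
    have degree at least 2 (r + 1).  This is what links the index r of PsiU k r,
    which bounds both the parts and the multiplicities of a partition of r, to
    the common precision N of all the series. *)
Lemma even_exp_trunc r d : eqX r.*2 (even_exp (r + d)) (even_exp r).
Proof.
have monE j m :
    (c j *: 'X^((j.+1).*2)) ^+ m = (c j ^+ m)%:P * 'X^((j.+1).*2 * m).
  by rewrite exprZn -exprM mul_polyC.
rewrite /even_exp big_split_ord /= -[X in eqX _ _ X]mulr1.
apply: eqX_mul; first apply: eqX_prod => j _.
  apply: expX_trunc => m rm; rewrite monE; apply: eqX_mulXn0.
  by rewrite -doubleMl ltn_double mulSn ltn_addr.
rewrite -[X in eqX _ _ X](@big1_eq _ _ *%R _ (index_enum 'I_d) xpredT).
apply: eqX_prod => j _.
have -> : 1 = expX 0 (c (r + j) *: 'X^((r + j).+1.*2)).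
  by rewrite /expX big_ord1 expr0 invr1 !scale1r.
rewrite -[(r + d)%N]add0n; apply: expX_trunc => -[//|m] _.
rewrite monE; apply: eqX_mulXn0.
by rewrite -doubleMl ltn_double mulnS ltn_addr // ltnS leq_addr.
Qed.

(** Choosing the term of exponent m_j in the factor of index j amounts to
    choosing the partition with m_j parts equal to j + 1. *)
Lemma coef_even_exp M i : (even_exp M)`_i =
  \sum_(m : {ffun 'I_M -> 'I_M.+1} | (\sum_(j < M) j.+1 * m j).*2 == i)
     \prod_(j < M) (((m j)`!%:R^-1 : rat) *: c j ^+ m j).
Proof.
suff -> : even_exp M = \sum_(m : {ffun 'I_M -> 'I_M.+1})
    (\prod_(j < M) (((m j)`!%:R^-1 : rat) *: c j ^+ m j)) *:
      'X^((\sum_(j < M) j.+1 * m j).*2)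
  by rewrite coef_sumMXn.
rewrite /even_exp /expX bigA_distr_bigA /=; apply: eq_bigr => m _.
rewrite -mul_polyC rmorph_prod /= -mul2n big_distrr /=.
rewrite -prodrXr -big_split /=.
apply: eq_bigr => j _.
rewrite mul_polyC exprZn scalerA mulr_algl -exprM -muln2; congr (_ *: 'X^_).
by rewrite (mulnC j.+1) mulnA.
Qed.

Lemma coef_even_exp_odd M i : odd i -> (even_exp M)`_i = 0.
Proof.
move=> i_odd; rewrite coef_even_exp big_pred0 // => m.
by apply: contraTF i_odd => /eqP <-; rewrite odd_double.
Qed.

Lemma logder_even_exp M :
  logder M (even_exp M)
    (\sum_(j < M) (c j *+ (j.+1).*2) *: 'X^((j.+1).*2)).
Proof.
by apply: logder_prod => j _; apply: logder_expX_monomial; rewrite double_gt0.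
Qed.

Lemma even_exp0 M : (even_exp M)`_0 = 1.
Proof. by rewrite (@even_exp_trunc 0 M 0) // /even_exp big_ord0 coef1. Qed.

End EvenExponential.

(** * Generating functions of Ytilde and T *)

Section SymmetricPolynomials.
Variable k : nat.
Local Notation R := {mpoly rat[k]}.

Definition psi_coef (j : nat) : R :=
  (bernoulli (j.+1).*2 / ((j.+1).*2%:R * ((j.+1).*2)`!%:R)) *:
    power_sum k (j.+1).*2.

Lemma PsiUE r :
  PsiU k r = ((r.*2.+1)`!%:R * 4 ^+ r) *: (even_exp psi_coef r)`_(r.*2).
Proof.
rewrite coef_even_exp /PsiU scaler_sumr; apply: eq_big => [m|m _].
  by rewrite /is_partition -(inj_eq double_inj).
rewrite /phiU -[LHS]scalerA; congr (_ *: _).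
rewrite /p_part -scaler_prod; apply: eq_bigr => j _.
by rewrite /psi_coef exprZn scalerA.
Qed.

Lemma sum_even (V : nmodType) (F : nat -> V) n :
  (forall i, odd i -> F i = 0) ->
  \sum_(i < n.+1) F i = \sum_(0 <= r < n./2.+1) F r.*2.
Proof.
move=> F0; elim: n => [|n IHn]; first by rewrite big_ord1 big_nat1.
rewrite big_ord_recr IHn /= uphalf_half; have [n_odd|n_even] := boolP (odd n).
  rewrite add1n [in RHS]big_nat_recr //=; congr (_ + F _).
  by rewrite -[in LHS](odd_double_half n) n_odd add1n doubleS.
by rewrite (F0 n.+1) ?addr0.
Qed.

(** Only the even coefficients of the second factor contribute, which gives the
    sum over r; the scalars match because
    n! / ((n - 2r)! (2r + 1)!) = C(n + 1, 2r + 1) / (n + 1). *)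
Lemma Ytilde_gf n N : (n <= N)%N ->
  Ytilde k n = n`!%:R *:
    (expX N ((2^-1 *: power_sum k 1) *: 'X) * even_exp psi_coef N)`_n.
Proof.
move=> nN; set E := expX _ _; set G := even_exp _ _.
rewrite mulrC coefM (@sum_even _ (fun i => G`_i * E`_(n - i))); last first.
  by move=> i i_odd; rewrite /G coef_even_exp_odd ?mul0r.
rewrite /Ytilde !scaler_sumr !big_mkord; apply: eq_bigr => -[r /= rn] _.
have rn2 : (r.*2 <= n)%N by rewrite -geq_half_double.
have rN : (r <= N)%N.
  by rewrite (leq_trans _ (leq_trans rn2 nN)) // -addnn leq_addr.
rewrite PsiUE /E /G coef_expX_linear ?(leq_trans (leq_subr _ _)) // exprZn.
have -> : (even_exp psi_coef N)`_(r.*2) = (even_exp psi_coef r)`_(r.*2).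
  by rewrite -{1}(subnKC rN) even_exp_trunc.
rewrite -!scalerAr !scalerA [in RHS]mulrC; congr (_ *: _); last exact: mulrC.
have binE : 'C(n.+1, r.*2.+1)%:R * ((r.*2.+1)`!%:R * (n - r.*2)`!%:R) =
    n.+1%:R * n`!%:R :> rat.
  by rewrite -!natrM -factS -subSS bin_fact.
have n1 : n.+1%:R != 0 :> rat by rewrite pnatr_eq0.
have powE : 2 ^+ n = 2 ^+ (n - r.*2) * 4 ^+ r :> rat.
  by rewrite -{1}(subnK rn2) exprD -mul2n exprM.
rewrite powE exprVn -[n`!%:R](mulKf n1) -binE.
have := factr_neq0 (n - r.*2); move: (_`!%:R) => b b0; field.
by rewrite nat1r n1 b0 !expf_neq0.
Qed.

Lemma coef_signM m (p : {poly R}) i :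
  ((-1) ^+ m * p)`_i = ((-1) ^+ m : rat) *: p`_i.
Proof.
rewrite -(signr_odd {poly R}) -(signr_odd rat).
case: (odd m); rewrite ?expr0 ?expr1 ?mul1r ?scale1r //.
by rewrite mulN1r coefN scaleN1r.
Qed.

(** The product expands into the exponentials of (\sum_(j in S) x_j) X with sign
    (-1)^(k - |S|).  The empty set, left out of altP, contributes a constant,
    hence the hypothesis on N. *)
Lemma altP_gf N : (0 < N)%N ->
  Defs.altP k N = ((-1) ^+ k.+1 * N`!%:R) *:
    (\prod_(i < k) (expX N (('X_i : R) *: 'X) - 1))`_N.
Proof.
move=> N0; rewrite bigA_distr /= coef_sum.
rewrite (eq_bigr (fun S : {set 'I_k} =>
    ((-1) ^+ #|~: S| * N`!%:R^-1) *: (\sum_(j in S) ('X_j : R)) ^+ N));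
  last first.
  move=> S _; rewrite big_if /=.
  rewrite [X in _ * X](eq_bigl (fun i => i \in ~: S)) ; last first.
    by move=> i; rewrite inE.
  rewrite prodr_const [_ * _]mulrC coef_signM -scalerA; congr (_ *: _).
  by rewrite prod_expX_linear // coef_expX_linear.
rewrite (bigD1 set0) //= big_set0 expr0n gtn_eqF // scaler0 add0r.
rewrite scaler_sumr; apply: eq_bigr => S S0; rewrite scalerA; congr (_ *: _).
rewrite -card_gt0 in S0.
have -> : (-1) ^+ k.+1 = (-1) ^+ (#|S| + #|~: S|).+1 :> rat.
  by rewrite cardsC card_ord.
rewrite mulrACA divff ?factr_neq0 // mulr1.
rewrite -(prednK S0) !addSn !exprS !mulN1r opprK exprD -mulrA.
by rewrite -expr2 sqrr_sign mulr1.
Qed.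

Lemma T_gf n : (0 < k)%N ->
  T k n = n`!%:R *: (\prod_(i < k) expm1_div (n + k) ('X_i : R))`_n.
Proof.
move=> k0; apply/esym/T_eqnP; rewrite /T_eqn altP_gf ?addn_gt0 ?k0 ?orbT //.
set N := (n + k)%N.
have eN : eqX N (\prod_(i < k) (expX N (('X_i : R) *: 'X) - 1))
   ((\prod_(i < k) 'X_i) *: (\prod_(i < k) expm1_div N ('X_i : R) * 'X^k)).
  apply: (@eqX_trans _ _ _
    (\prod_(i < k) (('X_i : R) *: 'X * expm1_div N 'X_i))).
    apply: eqX_prod => i _.
    rewrite -[X in eqX _ _ X](addrK 1) [X in eqX _ _ (X - _)]addrC.
    by apply: eqX_add => //; apply: expX_expm1_div.
  rewrite big_split /= scaler_prod prodr_const card_ord.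
  by rewrite -scalerAl mulrC.
rewrite eN // coefZ coefMXn ltnNge leq_addl /= addnK.
rewrite -!scalerAr scalerA; congr (_ *: _).
by rewrite -mulrA mulfVK ?factr_neq0.
Qed.

End SymmetricPolynomials.

Theorem theorem1p3 (k n : nat) (hk : (0 < k)%N) (hn : (0 < n)%N) :
  Ytilde k n = T k n.
Proof.
rewrite (@Ytilde_gf k n (n + k)) ?leq_addr // T_gf //; congr (_ *: _).
set N := (n + k)%N.
(* The even form of the logarithmic derivative of (e^(xX) - 1) / (xX). *)
pose L (x : {mpoly rat[k]}) : {poly {mpoly rat[k]}} :=
  (2^-1 *: x) *: 'X + \sum_(j < N)
    ((bernoulli (j.+1).*2 / ((j.+1).*2)`!%:R) *: x ^+ (j.+1).*2)
      *: 'X^((j.+1).*2).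
suff /(_ n (leq_addr _ _)) :
  eqX N (expX N ((2^-1 *: power_sum k 1) *: 'X) * even_exp (psi_coef k) N)
        (\prod_(i < k) expm1_div N 'X_i) by [].
apply: (@logder_inj _ _ _ _ (\sum_(i < k) L 'X_i)).
- rewrite coef_sum big1 // => i _; rewrite coefD !coefZ coefX mulr0 add0r.
  rewrite coef_sumMXn big_pred0 // => j; by [].
- rewrite coef0M even_exp0 expX0 ?linear0 // mulr1 coef0_prod big1 // => i _.
  by rewrite coef_expm1_div // invr1 scale1r.
- have := logder_mul (@logder_expX_linear _ N (2^-1 *: power_sum k 1))
                     (@logder_even_exp _ (psi_coef k) N).
  congr (logder _ _ _); rewrite /L big_split /=; congr (_ + _).
    by rewrite -scaler_suml -scaler_sumr.
  rewrite exchange_big /=; apply: eq_bigr => j _.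
  rewrite -scaler_suml -scaler_sumr; congr (_ *: _).
  rewrite /psi_coef -scaler_nat scalerA; congr (_ *: _).
  by rewrite invfM mulrCA mulVKf // pnatr_eq0 double_eq0.
- apply: logder_prod => i _.
  exact: (logder_eqX (@bernoulli_gf_even _ _ _) (@logder_expm1_div _ _ _)).
Qed.
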